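(* Let $R$ be a ring, let $\mathcal C$ be a full subcategory of $\operatorname{Mod-}R$ all of whose objects are slender right $R$-modules, and let $\mathcal P$ be a completely prime ideal of $\mathcal C$. Let $\{A_i\mid i\in I\}$ and $\{B_j\mid j\in J\}$ be families of objects of $\mathcal C$ with $|I|$, $|J|$ non-measurable. Assume: (a) for every object $A$ of $\mathcal C$, $\mathcal P(A,A)$ is a maximal right ideal of $\operatorname{End}_R(A)$; (b) in each of the two families, each $\mathcal P$ class contains at most countably many members; (c) $\prod_{i\in I}A_i\cong\prod_{j\in J}B_j$. Then there is a bijection $\sigma\colon I\to J$ with $[A_i]_{\mathcal P}=[B_{\sigma(i)}]_{\mathcal P}$ for every $i\in I$.
   Context: A completely prime ideal $\mathcal P$ of a full subcategory $\mathcal C$ of $\operatorname{Mod-}R$ consists of a subgroup $\mathcal P(A,B)$ of $\operatorname{Hom}_R(A,B)$ for each pair of objects $A,B$ of $\mathcal C$ such that: (1) for all objects $A,B,C$ and morphisms $f\colon A\to B$, $g\colon B\to C$, one has $gf\in\mathcal P(A,C)$ if and only if $f\in\mathcal P(A,B)$ or $g\in\mathcal P(B,C)$; (2) $\mathcal P(A,A)\neq\operatorname{Hom}_R(A,A)$ for every object $A$. For objects $A,B$, write $[A]_{\mathcal P}=[B]_{\mathcal P}$ (''same $\mathcal P$ class'') if $\mathcal P(A,B)\ne\operatorname{Hom}_R(A,B)$ and $\mathcal P(B,A)\neq\operatorname{Hom}_R(B,A)$. A right $R$-module $M$ is slender if for every homomorphism $f\colon R^\omega=\prod_{n<\omega}e_nR\to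 M$ (with $e_n$ the element having $1$ in position $n$ and $0$ elsewhere) there is $n_0$ with $f(e_n)=0$ for all $n\ge n_0$. *)

(* Defs.v *)
(* Right R-modules are modelled as left modules over the
   converse ring R^c : for (r : R^c) and m : M, r *: m denotes m.r . *)
From HB Require Import structures.
From mathcomp Require Import all_boot all_order all_algebra.
Set Implicit Arguments. Unset Strict Implicit. Unset Printing Implicit Defensive.
Import GRing.Theory.
Local Open Scope ring_scope.

Section Defs.
Variable R : nzRingType.

Definition is_rhom (A B : lmodType R^c) (f : A -> B) : Prop :=
  (forall x y : A, f (x + y) = f x + f y) /\
  (forall (r : R^c) (x : A), f (r *: x) = r *: f x).

Definition omega_unit (n : nat) : nat -> R :=
  fun k => if k == n then 1 else 0.

Definition is_rhom_from_omega (M : lmodType R^c) (f : (nat -> R) -> M) : Prop :=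
  (forall x y : nat -> R, f (fun n => x n + y n) = f x + f y) /\
  (forall (r : R) (x : nat -> R), f (fun n => x n * r) = (r : R^c) *: f x).

Definition slender (M : lmodType R^c) : Prop :=
  forall f : (nat -> R) -> M, is_rhom_from_omega f ->
    exists n0 : nat, forall n : nat, (n0 <= n)%N -> f (omega_unit n) = 0.

(* A full subcategory C of Mod-R: objects indexed by Obj, carried by Mod;
   morphisms are all R-homomorphisms. An ideal assigns to each pair of
   objects a set of morphisms. *)
Definition subgroup_of_hom (A B : lmodType R^c) (S : (A -> B) -> Prop) : Prop :=
  (forall f, S f -> is_rhom f) /\
  S (fun _ => 0) /\
  (forall f g, S f -> S g -> S (fun x => f x - g x)).

Definition completely_prime (Obj : Type) (Mod : Obj -> lmodType R^c)
    (P : forall X Y : Obj, (Mod X -> Mod Y) -> Prop) : Prop :=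
  (forall X Y, subgroup_of_hom (P X Y)) /\
  (forall X Y Z (f : Mod X -> Mod Y) (g : Mod Y -> Mod Z),
      is_rhom f -> is_rhom g ->
      (P X Z (fun x => g (f x)) <-> (P X Y f \/ P Y Z g))) /\
  (forall X, exists f : Mod X -> Mod X, is_rhom f /\ ~ P X X f).

Definition same_class (Obj : Type) (Mod : Obj -> lmodType R^c)
    (P : forall X Y : Obj, (Mod X -> Mod Y) -> Prop) (X Y : Obj) : Prop :=
  (exists f : Mod X -> Mod Y, is_rhom f /\ ~ P X Y f) /\
  (exists g : Mod Y -> Mod X, is_rhom g /\ ~ P Y X g).

Definition right_ideal_End (A : lmodType R^c) (S : (A -> A) -> Prop) : Prop :=
  subgroup_of_hom S /\
  (forall f g, S f -> is_rhom g -> S (fun x => f (g x))).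

Definition maximal_right_ideal_End (A : lmodType R^c) (S : (A -> A) -> Prop) : Prop :=
  right_ideal_End S /\
  (exists f, is_rhom f /\ ~ S f) /\
  (forall T, right_ideal_End T -> (forall f, S f -> T f) ->
     (forall f, T f -> S f) \/ (forall f, is_rhom f -> T f)).

Definition prod_add (I : Type) (F : I -> lmodType R^c) (x y : forall i, F i) :
  forall i, F i := fun i => x i + y i.
Definition prod_scale (I : Type) (F : I -> lmodType R^c) (r : R^c) (x : forall i, F i) :
  forall i, F i := fun i => r *: x i.

Definition prod_iso (I J : Type) (F : I -> lmodType R^c) (G : J -> lmodType R^c) : Prop :=
  exists f : (forall i, F i) -> (forall j, G j),
    (forall x y, f (prod_add x y) = prod_add (f x) (f y)) /\
    (forall r x, f (prod_scale r x) = prod_scale r (f x)) /\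
    bijective f.
End Defs.

Definition countable_pred (T : Type) (S : T -> Prop) : Prop :=
  exists h : {t : T | S t} -> nat, injective h.

Definition ctbly_complete_ultrafilter (I : Type) (U : (I -> Prop) -> Prop) : Prop :=
  ~ U (fun _ => False) /\
  (forall X Y : I -> Prop, U X -> (forall i, X i -> Y i) -> U Y) /\
  (forall X : nat -> I -> Prop, (forall n, U (X n)) -> U (fun i => forall n, X n i)) /\
  (forall X : I -> Prop, U X \/ U (fun i => ~ X i)).

Definition non_measurable (I : Type) : Prop :=
  forall U, ctbly_complete_ultrafilter U -> exists i0 : I, U (fun i => i = i0).

(* Main.v *)
Require Import Defs.
From HB Require Import structures.
From mathcomp Require Import all_boot all_order all_algebra boolp.
Set Implicit Arguments. Unset Strict Implicit. Unset Printing Implicit Defensive.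
Import GRing.Theory.
Local Open Scope ring_scope.

(** By a Los-type theorem, a homomorphism from a product indexed by a
    non-measurable set to a slender module is a finite sum of homomorphisms of
    the factors.  An isomorphism of the two products and its inverse are
    therefore row-finite matrices (f_ji), (g_ij), and sum_j g_kj f_ji is the
    Kronecker delta.  Since P(A,A) is both completely prime and a maximal right
    ideal, End(A)/P(A,A) is a division ring, and modulo P each class becomes a
    groupoid with zero over a division ring.  Linear algebra over it shows that
    n members of a class in one family force n members of that class in the
    other.  As the classes are countable, enumerating the members of each class
    and matching those of equal rank gives the bijection. *)

(** * Homomorphisms from a product to a slender module *)

Definition prod_hom (R : nzRingType) (I : Type) (F : I -> lmodType R^c)
    (M : lmodType R^c) (phi : (forall i, F i) -> M) : Prop :=
  (forall x y, phi (prod_add x y) = phi x + phi y) /\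
  (forall r x, phi (prod_scale r x) = r *: phi x).

Definition inj_coord (R : nzRingType) (I : eqType) (F : I -> lmodType R^c)
    (i : I) (a : F i) : forall k, F k := dfwith (fun k => 0 : F k) a.

Section ProductHom.
Variables (R : nzRingType) (I : Type) (F : I -> lmodType R^c) (M : lmodType R^c).
Variable phi : (forall i, F i) -> M.
Hypothesis phi_hom : prod_hom phi.

Lemma prod_hom0 : phi (fun _ => 0) = 0.
Proof.
have [_ phiZ] := phi_hom; rewrite -[RHS](scale0r (phi (fun _ => 0))) -phiZ.
by congr phi; apply: functional_extensionality_dep => i; rewrite /prod_scale scale0r.
Qed.

Lemma prod_hom_sum (K : Type) (s : seq K) (y : K -> forall i, F i) :
  phi (fun i => \sum_(k <- s) y k i) = \sum_(k <- s) phi (y k).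
Proof.
elim: s => [|k s IHs].
  rewrite big_nil -[RHS]prod_hom0; congr phi.
  by apply: functional_extensionality_dep => i; rewrite big_nil.
rewrite big_cons -IHs -(proj1 phi_hom); congr phi.
by apply: functional_extensionality_dep => i; rewrite big_cons.
Qed.

Hypothesis M_slender : slender M.

(** The infinite sum of the [r n *: x n] is finite in each coordinate, so it defines an element of
    the product. Applying [phi] gives a homomorphism on the countable power of R that sends
    [omega_unit n] to [phi (x n)]. *)
Lemma slender_vanish (x : nat -> forall i, F i) :
  (forall i, exists N : nat, forall n : nat, (N <= n)%N -> x n i = 0) ->
  exists n0 : nat, forall n : nat, (n0 <= n)%N -> phi (x n) = 0.
Proof.
move=> /choice[N xN].
pose f (r : nat -> R) := phi (fun i => \sum_(n <- iota 0 (N i)) (r n : R^c) *: x n i).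
have f_hom : is_rhom_from_omega f.
  split=> [r s|r s]; rewrite /f.
    rewrite -(proj1 phi_hom); congr phi; apply: functional_extensionality_dep => i.
    by rewrite /prod_add -big_split; apply: eq_bigr => n _; exact: scalerDl.
  rewrite -(proj2 phi_hom); congr phi; apply: functional_extensionality_dep => i.
  by rewrite /prod_scale scaler_sumr; apply: eq_bigr => n _; rewrite scalerA.
have [n0 fn0] := M_slender f_hom; exists n0 => n /fn0 <-; congr phi.
apply: functional_extensionality_dep => i.
have [lt_nN|le_Nn] := ltnP n (N i).
  rewrite (bigD1_seq n) ?iota_uniq ?mem_iota //= /omega_unit eqxx scale1r.
  by rewrite big1 ?addr0 // => k /negPf ->; rewrite scale0r.
rewrite xN // big1_seq // => k /=; rewrite mem_iota add0n => lt_kN.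
by rewrite /omega_unit ltn_eqF ?scale0r //; apply: leq_trans le_Nn.
Qed.

Definition restr (X : I -> Prop) (x : forall i, F i) : forall i, F i :=
  fun i => if `[< X i >] then x i else 0.

(** The null sets form a sigma-ideal ([nullS], [nullU], [null_bigcup]); the ultrafilter in
    [nonnull_point] is built from it. *)
Definition null (X : I -> Prop) : Prop := forall x, phi (restr X x) = 0.

Lemma restr_in (X : I -> Prop) x i : X i -> restr X x i = x i.
Proof. by move=> Xi; rewrite /restr asboolT. Qed.

Lemma restr_out (X : I -> Prop) x i : ~ X i -> restr X x i = 0.
Proof. by move=> Xi; rewrite /restr asboolF. Qed.

Lemma nullS (X Y : I -> Prop) : (forall i, X i -> Y i) -> null Y -> null X.
Proof.
move=> sXY nY x; rewrite -(nY (restr X x)); congr phi.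
apply: functional_extensionality_dep => i; have [Yi|Yi] := pselect (Y i).
  by rewrite [RHS]restr_in.
by rewrite !restr_out // => /sXY.
Qed.

Lemma restr_split (X Y : I -> Prop) x :
  phi (restr X x) =
  phi (restr (fun i => X i /\ Y i) x) + phi (restr (fun i => X i /\ ~ Y i) x).
Proof.
rewrite -(proj1 phi_hom); congr phi; apply: functional_extensionality_dep => i.
rewrite /prod_add; have [Xi|Xi] := pselect (X i); last first.
  by rewrite !restr_out ?addr0 // => -[].
have [Yi|Yi] := pselect (Y i).
  by rewrite (restr_in _ Xi) (restr_in _ (conj Xi Yi)) restr_out ?addr0 // => -[].
by rewrite (restr_in _ Xi) (restr_in _ (conj Xi Yi)) restr_out ?add0r // => -[].
Qed.

Lemma nullU (X Y : I -> Prop) :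
  null (fun i => X i /\ Y i) -> null (fun i => X i /\ ~ Y i) -> null X.
Proof. by move=> nXY nXnY x; rewrite (restr_split X Y) nXY nXnY addr0. Qed.

(** The part of [x] outside the first n sets is eventually zero in each coordinate, so by
    slenderness [phi] kills it for some n. What remains lives on a finite union of null sets. *)
Lemma null_bigcup (W : nat -> I -> Prop) :
  (forall n, null (W n)) -> null (fun i => exists n, W n i).
Proof.
move=> nW x; set V := fun i => _.
pose T n i := exists2 k, (k < n)%N & W k i.
have nT n : null (T n).
  elim: n => [|n IHn]; first by apply: nullS (nW 0) => i [].
  apply: (@nullU _ (W n)); first by apply: nullS (nW n) => i [].
  apply: nullS IHn => i [[k lt_kn Wki] nWni]; exists k => //.
  rewrite ltnS leq_eqVlt in lt_kn; case/orP: lt_kn => [/eqP kn|//].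
  by rewrite kn in Wki.
have [] := @slender_vanish (fun n => restr (fun i => V i /\ ~ T n i) x).
  move=> i; have [[k Wki]|nVi] := pselect (V i).
    exists k.+1 => n lt_kn; rewrite restr_out // => -[_]; apply.
    by exists k.
  by exists 0%N => n _; rewrite restr_out // => -[].
move=> n0 /(_ n0 (leqnn _)) phin0.
rewrite (restr_split V (T n0)) phin0 addr0.
by apply: (nullS _ (nT n0)) => i [].
Qed.

(* Otherwise X could be split forever, leaving infinitely many disjoint
   non-null pieces, which contradicts slenderness. *)
Lemma exists_unsplit (X : I -> Prop) : ~ null X ->
  exists Y : I -> Prop, [/\ forall i, Y i -> X i, ~ null Y &
    forall Z : I -> Prop,
      null (fun i => Y i /\ Z i) \/ null (fun i => Y i /\ ~ Z i)].
Proof.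
move=> nnX; apply: contrapT => noY.
have split1 (Y : {Y : I -> Prop | ~ null Y /\ forall i, Y i -> X i}) :
    exists Z : I -> Prop, ~ null (fun i => sval Y i /\ Z i) /\
      ~ null (fun i => sval Y i /\ ~ Z i).
  case: Y => Y /= [nnY sYX]; apply: contrapT => noZ; apply: noY.
  exists Y; split=> // Z; apply: contrapT => /not_orP nor.
  by apply: noZ; exists Z.
have {split1} [c cP] := choice split1.
pose next (Y : {Y : I -> Prop | ~ null Y /\ forall i, Y i -> X i}) :
    {Y : I -> Prop | ~ null Y /\ forall i, Y i -> X i} :=
  exist _ (fun i => sval Y i /\ c Y i)
    (conj (proj1 (cP Y)) (fun i Yi => proj2 (svalP Y) i (proj1 Yi))).
pose Y n := iter n next (exist _ X (conj nnX (fun i Xi => Xi))).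
pose W n i := sval (Y n) i /\ ~ c (Y n) i.
have YW n k i : sval (Y (n + k.+1)%N) i -> ~ W n i.
  elim: k i => [|k IHk] i; first by rewrite addn1 => -[Yi cYi] [].
  by rewrite addnS => -[/IHk].
have [|w phiw] := @choice _ _ (fun n wn => phi (restr (W n) wn) <> 0).
  by move=> n; have [_ /existsNP] := cP (Y n).
have [] := @slender_vanish (fun n => restr (W n) (w n)).
  move=> i; have [[n Wni]|nW] := pselect (exists n, W n i).
    exists n.+1 => k lt_nk; rewrite restr_out // => -[Yki _].
    by apply: (YW n (k - n.+1)%N i) Wni; rewrite addnS -addSn subnKC.
  by exists 0%N => k _; rewrite restr_out // => Wki; apply: nW; exists k.
by move=> n0 /(_ n0 (leqnn _)) /phiw.
Qed.

Hypothesis I_nm : non_measurable I.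

(** Inside an unsplittable [Y], the sets whose complement in [Y] is null form a countably complete
    ultrafilter. Non-measurability makes it principal, and its point lies in [Y] and is itself
    non-null. *)
Lemma nonnull_point (X : I -> Prop) : ~ null X ->
  exists2 i, X i & ~ null (fun k => k = i).
Proof.
move=> /exists_unsplit[Y [sYX nnY Yu]].
have [|i0] := I_nm (U := fun X => null (fun i => Y i /\ ~ X i)).
  split; first by move=> n0; apply: nnY; apply: nullS n0 => i Yi; split.
  split; first by move=> Z Z' nZ sZ; apply: nullS nZ => i [Yi nZ']; split=> // /sZ.
  split=> [Z nZ|Z]; last first.
    have [nYZ|nYZ] := Yu Z; last by left.
    by right; apply: nullS nYZ => i [Yi /contrapT Zi].
  apply: nullS (null_bigcup nZ) => i [Yi /existsNP[n nZni]]; by exists n.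
move=> nYi0; exists i0.
  apply: sYX; apply: contrapT => nYi; apply: nnY.
  by apply: nullS nYi0 => i Yi; split=> // ii0; rewrite ii0 in Yi.
by move=> ni0; apply: nnY; apply: nullU nYi0; apply: nullS ni0 => i [].
Qed.

End ProductHom.

(** Were no cofinite set null, [nonnull_point] would supply infinitely many distinct non-null
    points, and elements supported at these points would contradict [slender_vanish]. *)
Lemma slender_finite_support (R : nzRingType) (I : eqType)
    (F : I -> lmodType R^c) (M : lmodType R^c) (phi : (forall i, F i) -> M) :
  prod_hom phi -> slender M -> non_measurable I ->
  exists2 L : seq I, uniq L &
    forall x, phi x = \sum_(i <- L) phi (inj_coord (x i)).
Proof.
move=> phi_hom M_slender I_nm.
have [L nL] : exists L : seq I, null phi (fun i => i \notin L).
  apply: contrapT => noL.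
  have : forall L : seq I, exists i, i \notin L /\ ~ null phi (fun k => k = i).
    move=> L; have [|i iL nni] := @nonnull_point _ _ _ _ _ phi_hom M_slender I_nm
      (fun i => i \notin L); last by exists i.
    by move=> nL; apply: noL; exists L.
  move=> /choice[c cP].
  (* [s n] lists the first n chosen points and [c] avoids them, so the points are distinct and each
     coordinate is met at most once. *)
  pose s n := iter n (fun s => c s :: s) [::].
  have cs n k : c (s n) \in s (n + k.+1)%N.
    elim: k => [|k IHk]; first by rewrite addn1 /= in_cons eqxx.
    by rewrite addnS /= in_cons IHk orbT.
  have [|w phiw] :=
      @choice _ _ (fun n wn => phi (restr (fun k => k = c (s n)) wn) <> 0).
    by move=> n; have [_ /existsNP] := cP (s n).
  have [] := slender_vanish phi_hom M_slender
      (x := fun n => restr (fun k => k = c (s n)) (w n)).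
    move=> i; have [[n ->]|ni] := pselect (exists n, i = c (s n)).
      exists n.+1 => k lt_nk; rewrite restr_out // => cnk.
      have [/negP + _] := cP (s k); apply; rewrite -cnk -(subnKC lt_nk) addSn -addnS.
      exact: cs.
    by exists 0%N => k _; rewrite restr_out // => Wki; apply: ni; exists k.
  by move=> n0 /(_ n0 (leqnn _)) /phiw.
exists (undup L); first exact: undup_uniq.
move=> x; rewrite -(prod_hom_sum phi_hom).
have -> : phi x = phi (restr (fun _ => True) x).
  by congr phi; apply: functional_extensionality_dep => i; rewrite restr_in.
rewrite (restr_split phi_hom _ (fun i => i \in L)).
rewrite [X in _ + X](_ : _ = 0) ?addr0; last first.
  by apply: nullS nL x => i [_ /negP].
congr phi; apply: functional_extensionality_dep => i.
have [iL|niL] := pselect (is_true (i \in L)).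
  rewrite restr_in // (bigD1_seq i) ?mem_undup ?undup_uniq //=.
  rewrite /inj_coord dfwith_in big1 ?addr0 // => k ki.
  by rewrite dfwith_out.
rewrite restr_out => [|[]//]; rewrite big1_seq // => k /=.
rewrite mem_undup => kL; rewrite /inj_coord dfwith_out //.
by apply: contra_notN niL => /eqP <-.
Qed.

(** * Module homomorphisms and coordinate injections *)

Section Rhom.
Variable R : nzRingType.
Implicit Types A B C : lmodType R^c.

Lemma is_rhom_id A : is_rhom (fun x : A => x).
Proof. by []. Qed.

Lemma is_rhom0 A B : is_rhom (fun _ : A => 0 : B).
Proof. by split=> *; rewrite ?addr0 ?scaler0. Qed.

Lemma is_rhom_comp A B C (f : A -> B) (g : B -> C) :
  is_rhom f -> is_rhom g -> is_rhom (fun x => g (f x)).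
Proof. by move=> [fD fZ] [gD gZ]; split=> *; rewrite ?fD ?gD ?fZ ?gZ. Qed.

Lemma is_rhomD A B (f g : A -> B) :
  is_rhom f -> is_rhom g -> is_rhom (fun x => f x + g x).
Proof.
move=> [fD fZ] [gD gZ]; split=> *; first by rewrite fD gD addrACA.
by rewrite fZ gZ scalerDr.
Qed.

Lemma is_rhomN A B (f : A -> B) : is_rhom f -> is_rhom (fun x => - f x).
Proof. by move=> [fD fZ]; split=> *; rewrite ?fD ?opprD ?fZ ?scalerN. Qed.

Lemma is_rhom_sum A B (K : Type) (s : seq K) (p : pred K) (f : K -> A -> B) :
  (forall k, is_rhom (f k)) -> is_rhom (fun x => \sum_(k <- s | p k) f k x).
Proof.
move=> fR; split=> [x y|r x].
  by rewrite -big_split; apply: eq_bigr => k _; rewrite (proj1 (fR k)).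
by rewrite scaler_sumr; apply: eq_bigr => k _; rewrite (proj2 (fR k)).
Qed.

Lemma rhom0 A B (f : A -> B) : is_rhom f -> f 0 = 0.
Proof. by move=> [_ fZ]; rewrite -[in LHS](scale0r 0) fZ scale0r. Qed.

Lemma rhomN A B (f : A -> B) x : is_rhom f -> f (- x) = - f x.
Proof. by move=> [_ fZ]; rewrite -scaleN1r fZ scaleN1r. Qed.

Lemma rhom_sum A B (f : A -> B) (K : Type) (s : seq K) (p : pred K) (x : K -> A) :
  is_rhom f -> f (\sum_(k <- s | p k) x k) = \sum_(k <- s | p k) f (x k).
Proof.
by move=> fR; apply: (big_morph f (proj1 fR)); apply: rhom0.
Qed.

Lemma inj_coord_rhom (I : eqType) (F : I -> lmodType R^c) i :
  (forall a b : F i, inj_coord (a + b) = prod_add (inj_coord a) (inj_coord b)) /\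
  (forall (r : R^c) (a : F i), inj_coord (r *: a) = prod_scale r (inj_coord a)).
Proof.
split=> [a b|r a]; apply: functional_extensionality_dep => k;
  rewrite /inj_coord /prod_add /prod_scale; have [ik|ik] := eqVneq i k.
- by move: a b; case: k / ik => a b; rewrite !dfwith_in.
- by rewrite !dfwith_out // addr0.
- by move: a; case: k / ik => a; rewrite !dfwith_in.
- by rewrite !dfwith_out // scaler0.
Qed.

Lemma prod_hom_coord (I J : eqType) (F : I -> lmodType R^c) (G : J -> lmodType R^c)
    (phi : (forall i, F i) -> (forall j, G j)) :
  (forall x y, phi (prod_add x y) = prod_add (phi x) (phi y)) ->
  (forall r x, phi (prod_scale r x) = prod_scale r (phi x)) ->
  forall j, prod_hom (fun x => phi x j).
Proof. by move=> phiD phiZ j; split=> *; rewrite ?phiD ?phiZ. Qed.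

Lemma prod_hom_inj_coord (I : eqType) (F : I -> lmodType R^c) (M : lmodType R^c)
    (phi : (forall i, F i) -> M) i :
  prod_hom phi -> is_rhom (fun a : F i => phi (inj_coord a)).
Proof.
move=> [phiD phiZ]; have [injD injZ] := inj_coord_rhom F i.
by split=> *; rewrite ?injD ?phiD ?injZ ?phiZ.
Qed.

End Rhom.

(** * Linear algebra modulo a completely prime ideal *)

Lemma dep_choice (T : Type) (F : T -> Type) (Q : forall i, F i -> Prop) :
  (forall i, exists y, Q i y) -> exists u : forall i, F i, forall i, Q i (u i).
Proof. by move=> QF; exists (fun i => sval (cid (QF i))) => i; case: cid. Qed.

Section CompletelyPrime.
Variables (R : nzRingType) (Obj : Type) (Mod : Obj -> lmodType R^c).
Variable P : forall X Y : Obj, (Mod X -> Mod Y) -> Prop.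
Hypothesis P_cp : completely_prime P.

Lemma cp_rhom X Y f : P (X := X) (Y := Y) f -> is_rhom f.
Proof. by case: P_cp => Psub _; case: (Psub X Y) => + _; apply. Qed.

Lemma cp0 X Y : P (X := X) (Y := Y) (fun _ => 0).
Proof. by case: P_cp => Psub _; case: (Psub X Y) => _ []. Qed.

Lemma cpB X Y f g : P (X := X) (Y := Y) f -> P g -> P (fun x => f x - g x).
Proof. by case: P_cp => Psub _; case: (Psub X Y) => _ [_]; apply. Qed.

Lemma cp_ext X Y f g : P (X := X) (Y := Y) f -> f =1 g -> P g.
Proof. by move=> Pf /funext <-. Qed.

Lemma cpN X Y f : P (X := X) (Y := Y) f -> P (fun x => - f x).
Proof. by move=> /(cpB (cp0 X Y)) /cp_ext; apply=> x; rewrite sub0r. Qed.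

Lemma cpD X Y f g : P (X := X) (Y := Y) f -> P g -> P (fun x => f x + g x).
Proof. by move=> Pf /cpN /(cpB Pf) /cp_ext; apply=> x; rewrite opprK. Qed.

Lemma cp_sum X Y (K : eqType) (s : seq K) (p : pred K) (f : K -> Mod X -> Mod Y) :
  (forall k, k \in s -> p k -> P (f k)) -> P (fun x => \sum_(k <- s | p k) f k x).
Proof.
elim: s => [|k s IHs] Pf.
  by apply: cp_ext (cp0 X Y) _ => x; rewrite big_nil.
have Ps : P (fun x => \sum_(k <- s | p k) f k x).
  by apply: IHs => i si; apply: Pf; rewrite in_cons si orbT.
case pk : (p k); last by apply: cp_ext Ps _ => x; rewrite big_cons pk.
apply: cp_ext (cpD (Pf k (mem_head _ _) pk) Ps) _ => x.
by rewrite big_cons pk.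
Qed.

Lemma cp_compP X Y Z (f : Mod X -> Mod Y) (g : Mod Y -> Mod Z) :
  is_rhom f -> is_rhom g -> P (fun x => g (f x)) <-> (P f \/ P g).
Proof. by case: P_cp => _ [+ _]; apply. Qed.

Lemma cp_compl X Y Z (f : Mod X -> Mod Y) (g : Mod Y -> Mod Z) :
  P f -> is_rhom g -> P (fun x => g (f x)).
Proof. by move=> Pf gR; apply/cp_compP; [exact: cp_rhom| |left]. Qed.

Lemma cp_compr X Y Z (f : Mod X -> Mod Y) (g : Mod Y -> Mod Z) :
  is_rhom f -> P g -> P (fun x => g (f x)).
Proof. by move=> fR Pg; apply/cp_compP; [|exact: cp_rhom|right]. Qed.

Definition nonP X Y : Prop := exists f : Mod X -> Mod Y, is_rhom f /\ ~ P f.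

Lemma nonP_trans X Y Z : nonP X Y -> nonP Y Z -> nonP X Z.
Proof.
move=> [f [fR Pf]] [g [gR Pg]]; exists (fun x => g (f x)).
split; first exact: is_rhom_comp.
by move=> /(cp_compP fR gR)[].
Qed.

Lemma same_class_refl X : same_class P X X.
Proof. by case: P_cp => _ [_ /(_ X) nPX]. Qed.

Lemma same_class_sym X Y : same_class P X Y -> same_class P Y X.
Proof. by case. Qed.

Lemma same_class_trans X Y Z :
  same_class P X Y -> same_class P Y Z -> same_class P X Z.
Proof.
move=> [XY YX] [YZ ZY].
by split; [apply: nonP_trans XY YZ | apply: nonP_trans ZY YX].
Qed.

Hypothesis P_max : forall X, maximal_right_ideal_End (P (X := X) (Y := X)).

(** [T] is the right ideal generated by [a] and [P]. It contains [a], which is outside [P], so by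
    maximality it contains the identity. *)
Lemma cp_right_inv X (a : Mod X -> Mod X) : is_rhom a -> ~ P a ->
  exists b : Mod X -> Mod X, is_rhom b /\ P (fun x => a (b x) - x).
Proof.
move=> aR nPa; have [_ [_ maxP]] := P_max X.
pose T h := exists b : Mod X -> Mod X, is_rhom b /\ P (fun x => a (b x) - h x).
have T_hom h : T h -> is_rhom h.
  move=> [b [bR /cp_rhom habR]].
  have := is_rhomD (is_rhom_comp bR aR) (is_rhomN habR).
  by congr is_rhom; apply: funext => x; rewrite opprB addrCA subrr addr0.
have := maxP T; case.
- split; last first.
    move=> h g [b [bR Pb]] gR; exists (fun x => b (g x)); split; first exact: is_rhom_comp.
    exact: (cp_compr gR Pb).
  split=> //; split.
    exists (fun _ => 0); split; first exact: is_rhom0.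
    by apply: cp_ext (cp0 _ _) _ => x; rewrite (rhom0 aR) subr0.
  move=> h h' [b [bR Pb]] [b' [bR' Pb']].
  exists (fun x => b x - b' x); split; first by apply: is_rhomD => //; apply: is_rhomN.
  apply: cp_ext (cpB Pb Pb') _ => x.
  by rewrite /= (proj1 aR) (rhomN _ aR) opprD addrACA -opprD.
- move=> h Ph; exists (fun _ => 0); split; first exact: is_rhom0.
  by apply: cp_ext (cpN Ph) _ => x; rewrite (rhom0 aR) sub0r.
- move=> sTP; case: nPa; apply: sTP; exists (fun x => x); split=> //.
  by apply: cp_ext (cp0 _ _) _ => x; rewrite subrr.
- by move=> /(_ _ (is_rhom_id _)).
Qed.

(** With [c] from [Y] to [X] outside [P], the endomorphism [phi] after [c] is outside [P], hence
    right invertible modulo [P]; so [phi] can serve as a pivot. *)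
Lemma cp_solve X X' Y (phi : Mod X -> Mod Y) (psi : Mod X' -> Mod Y) :
  nonP Y X -> is_rhom phi -> ~ P phi -> is_rhom psi ->
  exists t : Mod X' -> Mod X, is_rhom t /\ P (fun x => psi x - phi (t x)).
Proof.
move=> [c [cR nPc]] phiR nPphi psiR.
have [|b [bR Pb]] := cp_right_inv (is_rhom_comp cR phiR).
  by move=> /(cp_compP cR phiR)[].
exists (fun x => c (b (psi x))); split.
  exact: is_rhom_comp (is_rhom_comp psiR bR) cR.
by apply: cp_ext (cpN (cp_compr psiR Pb)) _ => x; rewrite opprB.
Qed.

(* Gaussian elimination modulo P: the pivot unknown p is eliminated through t. *)
Lemma cp_dependency (T : finType) (K : eqType) (Z : Obj) (X : T -> Obj) (Y : K -> Obj)
    (L : seq K) (S : {set T}) (f : forall j i, Mod (X i) -> Mod (Y j)) :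
  (size L < #|S|)%N ->
  (forall i, nonP Z (X i)) -> (forall j i, j \in L -> nonP (Y j) (X i)) ->
  (forall j i, is_rhom (f j i)) ->
  exists u : forall i, Mod Z -> Mod (X i),
    [/\ forall i, is_rhom (u i), exists2 i, i \in S & ~ P (u i) &
      forall j, j \in L -> P (fun z => \sum_(i in S) f j i (u i z))].
Proof.
elim: L S f => [|m L IHL] S f ltLS nPZ nPY fR.
  (* With no equations left, any family of morphisms outside [P] is a nontrivial solution. *)
  have [i Si] : exists i, i \in S by apply/set0Pn; rewrite -card_gt0.
  have [u uP] := dep_choice nPZ.
  exists u; split=> //; first by move=> k; case: (uP k).
  by exists i => //; case: (uP i).
have nPY' j i : j \in L -> nonP (Y j) (X i).
  by move=> Lj; apply: nPY; rewrite in_cons Lj orbT.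
(* If all coefficients of equation [m] over [S] lie in [P], every [u] satisfies it; otherwise one
   outside [P] is the pivot. *)
have [[p Sp nPp]|allP] := pselect (exists2 p, p \in S & ~ P (f m p)); last first.
  have [u [uR uS uL]] := IHL S f (ltnW ltLS) nPZ nPY' fR.
  exists u; split=> // j; rewrite in_cons => /orP[/eqP ->|/uL //].
  apply: cp_sum => i _ Si; apply: cp_compr => //.
  by apply: contrapT => nPi; apply: allP; exists i.
have [t tP] := dep_choice (fun i =>
   cp_solve (nPY m p (mem_head _ _)) (fR m p) nPp (fR m i)).
have tR i : is_rhom (t i) by case: (tP i).
have [||u [uR [q Sq nPq] uL]] :=
    IHL (S :\ p) (fun j i x => f j i x - f j p (t i x)) _ nPZ nPY'.
- by move: ltLS; rewrite (cardsD1 p) Sp.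
- move=> j i; apply: is_rhomD => //; apply: is_rhomN.
  exact: is_rhom_comp.
(* Back substitution: this value of the unknown [p] turns the full sums into the reduced ones, and
   makes each summand of equation [m] lie in [P]. *)
pose up z := - \sum_(i in S :\ p) t i (u i z).
have upR : is_rhom up.
  by apply/is_rhomN/is_rhom_sum => i; apply: is_rhom_comp.
pose v i : Mod Z -> Mod (X i) := dfwith (T := fun i => Mod Z -> Mod (X i)) u up i.
have vp : v p = up by rewrite /v dfwith_in.
have vE i : i != p -> v i = u i by move=> ip; rewrite /v dfwith_out // eq_sym.
have vsum j z : \sum_(i in S) f j i (v i z) =
    \sum_(i in S :\ p) (f j i (u i z) - f j p (t i (u i z))).
  rewrite (big_setD1 p) //= vp /up (rhomN _ (fR j p)) (rhom_sum _ _ _ (fR j p)) big_split /= sumrN addrC.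
  congr (_ - _); apply: eq_bigr => i; rewrite !inE => /andP[ip _].
  by rewrite vE.
exists v; split.
- move=> i; have [->|ip] := eqVneq i p; first by rewrite vp.
  by rewrite vE.
- by move: Sq; rewrite !inE => /andP[qp Sq]; exists q => //; rewrite vE.
move=> j; rewrite in_cons => /orP[/eqP ->|/uL Pj].
  suff : P (fun z => \sum_(i in S :\ p) (f m i (u i z) - f m p (t i (u i z)))).
    by move=> /cp_ext; apply=> z; rewrite vsum.
  apply: (cp_sum (f := fun i z => f m i (u i z) - f m p (t i (u i z)))) => i _ _.
  by have [_ Pi] := tP i; apply: cp_compr Pi.
by apply: cp_ext Pj _ => z; rewrite vsum.
Qed.

Hypothesis slenderP : forall X, slender (Mod X).

(** If too few [B j] in the class occur in the rows [e k] of [g], the corresponding equations have a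
    solution [u] with some component [u q] outside [P]. Mapping it by [f] and back by [g] recovers
    [u q] as a finite sum of members of [P], a contradiction. *)
Lemma class_transfer (I J : eqType) (A : I -> Obj) (B : J -> Obj)
    (f : (forall i, Mod (A i)) -> forall j, Mod (B j))
    (g : (forall j, Mod (B j)) -> forall i, Mod (A i)) (Z : Obj) (n : nat) (e : 'I_n -> I) :
  non_measurable J ->
  (forall j, prod_hom (fun x => f x j)) -> (forall i, prod_hom (fun y => g y i)) ->
  cancel f g -> injective e -> (forall k, same_class P (A (e k)) Z) ->
  exists e' : 'I_n -> J, injective e' /\ forall k, same_class P (B (e' k)) Z.
Proof.
move=> J_nm fR gR fK e_inj eZ.
have [supp suppP] : exists supp : I -> seq J, forall i y,
    g y i = \sum_(j <- supp i) g (inj_coord (y j)) i.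
  apply: (@dep_choice I (fun _ => seq J) (fun i s => forall y, g y i = \sum_(j <- s) g (inj_coord (y j)) i)) => i.
  by have [s _ sP] := slender_finite_support (gR i) (@slenderP (A i)) J_nm; exists s.
pose in_class j := `[< same_class P (B j) Z >].
pose L := [seq j <- undup (flatten [seq supp (e k) | k <- enum 'I_n]) | in_class j].
have L_class j : j \in L -> same_class P (B j) Z.
  by rewrite mem_filter => /andP[/asboolP].
have [le_nL|lt_Ln] := leqP n (size L).
  have /tuple_uniqP L_inj : uniq (in_tuple L) by rewrite filter_uniq ?undup_uniq.
  exists (fun k => tnth (in_tuple L) (widen_ord le_nL k)); split.
    by move=> k k' /L_inj/(congr1 val) /= /val_inj.
  by move=> k; apply: L_class; apply: mem_tnth.
pose fe j k (a : Mod (A (e k))) := f (inj_coord a) j.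
have feR j k : is_rhom (@fe j k) by apply: prod_hom_inj_coord (fR j).
pose ge k j (b : Mod (B j)) := g (inj_coord b) (e k).
have geR k j : is_rhom (@ge k j) by apply: prod_hom_inj_coord (gR (e k)).
have [|k|j k Lj||u [uR [q _ nPq] uL]] :=
    @cp_dependency 'I_n J Z (fun k => A (e k)) B L setT fe.
- by rewrite cardsT card_ord.
- by case: (eZ k).
- by have [] := same_class_trans (L_class j Lj) (same_class_sym (eZ k)).
- exact: feR.
case: nPq.
pose iota k (a : Mod (A (e k))) : forall i, Mod (A i) := inj_coord a.
(* The element of the product with entry [u k z] at each [e k] and zero elsewhere. *)
pose x (z : Mod Z) (i : I) := \sum_(k : 'I_n) iota k (u k z) i.
pose v j z := f (x z) j.
have vE j z : v j z = \sum_(k in setT) fe j k (u k z).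
  rewrite /v (prod_hom_sum (fR j) _ (fun k => iota k (u k z))).
  by apply: eq_bigl => k; rewrite in_setT.
have vR j : is_rhom (v j).
  have -> : v j = fun z => \sum_(k in setT) fe j k (u k z) by apply: funext => z.
  by apply: is_rhom_sum => k; apply: is_rhom_comp.
have uE z : u q z = \sum_(j <- supp (e q)) ge q j (v j z).
  rewrite -suppP fK /x (bigD1 q) //= /iota /inj_coord dfwith_in big1 ?addr0 // => k kq.
  by rewrite dfwith_out // (inj_eq e_inj).
(* If [ge q j] is outside [P], then either [B j] is in the class and the equations apply, or all
   [fe j k] lie in [P]: one outside it, together with [ge q j], would put [B j] in the class. *)
have Pv j : j \in supp (e q) -> P (fun z => ge q j (v j z)).
  move=> sj; have [Pg|nPg] := pselect (P (@ge q j)); first exact: cp_compr.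
  apply: cp_compl => //.
  have [cj|ncj] := boolP (in_class j).
    apply: (cp_ext (uL j _)) => [|z]; last by rewrite vE.
    rewrite mem_filter cj mem_undup; apply/flattenP; exists (supp (e q)) => //.
    by apply: map_f; rewrite mem_enum.
  have Pf k : P (@fe j k).
    apply: contrapT => nPf; case/asboolP: ncj; split.
      by apply: nonP_trans (proj1 (eZ q)); exists (@ge q j).
    by apply: nonP_trans (proj2 (eZ k)) _; exists (@fe j k).
  have : P (fun z => \sum_(k in setT) fe j k (u k z)).
    by apply: cp_sum => k _ _; apply: cp_compr.
  by move=> /cp_ext; apply=> z; rewrite vE.
apply: cp_ext (cp_sum (s := supp (e q)) (p := xpredT) (f := fun j z => ge q j (v j z)) _) _.
  by move=> j sj _; apply: Pv.
by move=> z; rewrite uE.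
Qed.

End CompletelyPrime.

(** * Ranks in a countable set *)

Section Rank.
Variables (T : Type) (S : T -> Prop).

(** Chosen from [S] alone, without a countability proof as argument, so that equal predicates have
    equal ranks. The constant 0 is a default for uncountable [S]. *)
Definition code : T -> nat :=
  match pselect (exists h : T -> nat, forall t t', S t -> S t' -> h t = h t' -> t = t')
  with left ex => sval (cid ex) | right _ => fun _ => 0%N end.

Definition is_code (n : nat) : bool := `[< exists2 t, S t & code t = n >].

Definition rank (t : T) : nat := count is_code (iota 0 (code t)).

Hypothesis S_ctbl : countable_pred S.

Lemma code_inj t t' : S t -> S t' -> code t = code t' -> t = t'.
Proof.
rewrite /code; case: pselect => [ex|nex]; first by case: cid => h /= h_inj; apply: h_inj.
case: nex; have [h h_inj] := S_ctbl.
exists (fun t => if pselect (S t) is left St then h (exist _ t St) else 0%N) => u v Su Sv.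
by case: pselect => // Su'; case: pselect => // Sv' /h_inj [].
Qed.

Lemma count_codeS n :
  count is_code (iota 0 n.+1) = (count is_code (iota 0 n) + is_code n)%N.
Proof. by rewrite -addn1 iotaD count_cat /= addn0. Qed.

Lemma leq_count_code m n : (m <= n)%N ->
  (count is_code (iota 0 m) <= count is_code (iota 0 n))%N.
Proof. by move=> /subnKC <-; rewrite iotaD count_cat leq_addr. Qed.

Lemma rank_inj t t' : S t -> S t' -> rank t = rank t' -> t = t'.
Proof.
move=> St St' rtt'; apply: code_inj => //.
wlog lt_tt' : t t' St St' rtt' / (code t < code t')%N.
  by move=> W; case: (ltngtP (code t) (code t')) => // lt; [|apply/esym]; apply: W.
have := leq_count_code lt_tt'; rewrite count_codeS -/(rank t) -/(rank t') rtt'.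
have -> : is_code (code t) by apply/asboolP; exists t.
by rewrite addn1 ltnn.
Qed.

(** With [tuple_rank], this makes the existence of a member of rank r equivalent to that of r+1
    distinct members, the property that [class_transfer] preserves. *)
Lemma rank_tuple t : S t ->
  exists e : 'I_(rank t).+1 -> T, injective e /\ forall k, S (e k).
Proof.
move=> St; pose s := [seq n <- iota 0 (code t).+1 | is_code n].
have size_s : size s = (rank t).+1.
  rewrite size_filter count_codeS -/(rank t).
  have -> : is_code (code t) by apply/asboolP; exists t.
  by rewrite addn1.
(* Each entry of [s] has passed the filter [is_code], so it is the code of a member of [S]. *)
have [e eP] := @choice 'I_(rank t).+1 T (fun k u => S u /\ code u = nth 0%N s k)
  (fun k => let P := mem_nth 0%N (etrans (congr1 (leq k.+1) size_s) (ltn_ord k)) in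
    let: ex_intro2 u Su cu := asboolW (proj1 (andP (etrans (esym (mem_filter _ _ _)) P))) in
    ex_intro _ u (conj Su cu)).
exists e; split=> [k k' ekk'|k]; last by case: (eP k).
have := proj2 (eP k); rewrite ekk' (proj2 (eP k')) => /eqP.
by rewrite nth_uniq ?size_s // ?filter_uniq ?iota_uniq // => /eqP/val_inj.
Qed.

Lemma tuple_rank r (e : 'I_r.+1 -> T) : injective e -> (forall k, S (e k)) ->
  exists2 t, S t & rank t = r.
Proof.
move=> e_inj Se.
have exN : exists N, (r < count is_code (iota 0 N))%N.
  exists (\max_k code (e k)).+1; rewrite -size_filter.
  apply: (@leq_trans (size [seq code (e k) | k <- enum 'I_r.+1])).
    by rewrite size_map size_enum_ord.
  apply: uniq_leq_size.
    rewrite map_inj_uniq ?enum_uniq // => k k' /= /code_inj ekk'.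
    by apply: e_inj; apply: ekk'.
  move=> _ /mapP[k _ ->]; rewrite mem_filter mem_iota /= add0n ltnS.
  by rewrite (leq_bigmax k) andbT; apply/asboolP; exists (e k).
(* At the least bound with more than r codes below it, the count has just jumped from r to r+1, so
   its predecessor is the code of a member of rank r. *)
case: (ex_minnP exN) => -[|N] // lt_rN minN.
have := lt_rN; rewrite count_codeS.
have : (count is_code (iota 0 N) <= r)%N.
  by rewrite leqNgt; apply/negP => /minN; rewrite ltnn.
have [/asboolP[t St cN]|] := boolP (is_code N); last by rewrite addn0 leqNgt => _ /negP.
rewrite addn1 ltnS => le1 le2; exists t => //.
by apply/eqP; rewrite eqn_leq /rank cN le1.
Qed.

End Rank.

(** * Matching members of equal class and rank *)

Section ClassMembers.
Variables (R : nzRingType) (Obj : Type) (Mod : Obj -> lmodType R^c).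
Variable P : forall X Y : Obj, (Mod X -> Mod Y) -> Prop.
Hypothesis P_cp : completely_prime P.

Definition members (I : Type) (A : I -> Obj) (Z : Obj) (i : I) : Prop :=
  same_class P (A i) Z.

(** Equality of predicates, rather than equivalence, allows rewriting inside [rank]. *)
Lemma members_eq (I : Type) (A : I -> Obj) (Z Z' : Obj) :
  same_class P Z Z' -> members A Z = members A Z'.
Proof.
move=> ZZ'; apply: funext => i; apply: propext; split=> AZ.
  exact: same_class_trans AZ ZZ'.
exact: same_class_trans AZ (same_class_sym ZZ').
Qed.

Hypothesis P_max : forall X, maximal_right_ideal_End (P (X := X) (Y := X)).
Hypothesis slenderP : forall X, slender (Mod X).

Lemma equal_rank_member (I J : eqType) (A : I -> Obj) (B : J -> Obj)
    (f : (forall i, Mod (A i)) -> forall j, Mod (B j))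
    (g : (forall j, Mod (B j)) -> forall i, Mod (A i)) :
  non_measurable J ->
  (forall j, prod_hom (fun x => f x j)) -> (forall i, prod_hom (fun y => g y i)) ->
  cancel f g ->
  (forall i, countable_pred (members A (A i))) ->
  (forall j, countable_pred (members B (B j))) ->
  forall i, exists j, same_class P (A i) (B j) /\
    rank (members A (A i)) i = rank (members B (B j)) j.
Proof.
move=> J_nm fR gR fK A_ctbl B_ctbl i.
have [e [e_inj eA]] := rank_tuple (S := members A (A i)) (same_class_refl P_cp (A i)).
have [e' [e'_inj e'B]] := class_transfer P_cp P_max slenderP J_nm fR gR fK e_inj eA.
have eqB j : members B (A i) j -> members B (B j) = members B (A i).
  exact: members_eq.
have [|j Bj rj] := tuple_rank (S := members B (A i)) _ e'_inj e'B.
  by rewrite -(eqB _ (e'B ord0)).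
by exists j; split; [apply: same_class_sym | rewrite eqB].
Qed.

(** The maps chosen in the two directions preserve class and rank, and these determine an index by
    [rank_inj]; hence the maps are mutually inverse. *)
Lemma class_bijection (I J : eqType) (A : I -> Obj) (B : J -> Obj) :
  non_measurable I -> non_measurable J ->
  (forall i, countable_pred (members A (A i))) ->
  (forall j, countable_pred (members B (B j))) ->
  prod_iso (fun i => Mod (A i)) (fun j => Mod (B j)) ->
  exists sigma : I -> J, bijective sigma /\
    forall i : I, same_class P (A i) (B (sigma i)).
Proof.
move=> I_nm J_nm A_ctbl B_ctbl [f [fD [fZ [g fK gK]]]].
have gD x y : g (prod_add x y) = prod_add (g x) (g y).
  by apply: (can_inj fK); rewrite fD !gK.
have gZ r x : g (prod_scale r x) = prod_scale r (g x).
  by apply: (can_inj fK); rewrite fZ !gK.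
have fR := prod_hom_coord fD fZ; have gR := prod_hom_coord gD gZ.
have [s sP] := choice (equal_rank_member J_nm fR gR fK A_ctbl B_ctbl).
have [t tP] := choice (equal_rank_member I_nm gR fR gK B_ctbl A_ctbl).
exists s; split; last by move=> i; case: (sP i).
exists t => [i|j].
  have [ABs rs] := sP i; have [BAt rt] := tP (s i).
  have cls : same_class P (A (t (s i))) (A i).
    exact: same_class_sym (same_class_trans P_cp ABs BAt).
  apply: (rank_inj (A_ctbl i)) => //; first exact: same_class_refl.
  by rewrite rs rt (members_eq _ cls).
have [BAt rt] := tP j; have [ABs rs] := sP (t j).
have cls : same_class P (B (s (t j))) (B j).
  exact: same_class_sym (same_class_trans P_cp BAt ABs).
apply: (rank_inj (B_ctbl j)) => //; first exact: same_class_refl.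
by rewrite rt rs (members_eq _ cls).
Qed.

End ClassMembers.

Theorem theorem5p5 (R : nzRingType) (Obj : Type) (Mod : Obj -> lmodType R^c)
  (P : forall X Y : Obj, (Mod X -> Mod Y) -> Prop)
  (I J : Type) (A : I -> Obj) (B : J -> Obj) :
  (forall X : Obj, slender (Mod X)) ->
  completely_prime P ->
  non_measurable I -> non_measurable J ->
  (forall X : Obj, maximal_right_ideal_End (P X X)) ->
  (forall i : I, countable_pred (fun i' : I => same_class P (A i') (A i))) ->
  (forall j : J, countable_pred (fun j' : J => same_class P (B j') (B j))) ->
  prod_iso (fun i => Mod (A i)) (fun j => Mod (B j)) ->
  exists sigma : I -> J, bijective sigma /\
    forall i : I, same_class P (A i) (B (sigma i)).
Proof.
move=> slenderP P_cp I_nm J_nm P_max A_ctbl B_ctbl AB_iso.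
(* [{classic I}] equips an arbitrary type with the decidable equality that coordinate injections
   require. *)
exact: (@class_bijection _ _ _ _ P_cp P_max slenderP {classic I} {classic J} A B).
Qed.
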